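(* Let $\mathcal{A}\in\mathbb{R}^{\ell\times p\times n}$ and suppose that $m\le\min\{\ell,p\}$ steps of the tensor Lanczos bidiagonalization algorithm have been applied to $\mathcal{A}$. Assume that $$\mathcal{A}\star\widetilde{\mathcal{P}}_{k+1}=\widetilde{\mathcal{Q}}_{k+1}\star\widetilde{\mathcal{B}}_{k+1},\qquad \mathcal{A}^H\star\widetilde{\mathcal{Q}}_{k+1}=\widetilde{\mathcal{P}}_{k+1}\star\widetilde{\mathcal{B}}_{k+1}^H+\widetilde{\bm{\beta}}_{k+1}\star\vec{\widetilde{\mathcal{P}}}_{k+2}\star\vec{\mathcal{E}}_{k+1}^H,$$ where $\widetilde{\mathcal{P}}_{k+1},\widetilde{\mathcal{Q}}_{k+1},\widetilde{\mathcal{B}}_{k+1},\vec{\widetilde{\mathcal{P}}}_{k+2},\widetilde{\bm{\beta}}_{k+1}$ form the Ritz-augmented decomposition described in the context. If the tubes $\widetilde{\bm{\beta}}_{k+1}$ are nonvanishing for $1\le k<m$, then there are $\widetilde{\mathcal{P}}_m\in\mathbb{R}^{p\times m\times n}$ and $\widetilde{\mathcal{Q}}_m\in\mathbb{R}^{\ell\times m\times n}$ with orthonormal lateral slices, an upper triangular tensor $\widetilde{\mathcal{B}}_m\in\mathbb{R}^{m\times m\times n}$, a tube $\widetilde{\bm{\beta}}_m\in\mathbb{R}^{1\times1\times n}$ and a lateral slice $\vec{\widetilde{\mathcal{P}}}_{m+1}\in\mathbb{R}^{p\times1\times n}$ orthogonal to $\widetilde{\mathcal{P}}_m$ such that $$\mathcal{A}\star\widetilde{\mathcal{P}}_m=\widetilde{\mathcal{Q}}_m\star\widetilde{\mathcal{B}}_m,\qquad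 \mathcal{A}^H\star\widetilde{\mathcal{Q}}_m=\widetilde{\mathcal{P}}_m\star\widetilde{\mathcal{B}}_m^H+\widetilde{\bm{\beta}}_m\star\vec{\widetilde{\mathcal{P}}}_{m+1}\star\vec{\mathcal{E}}_m^H,$$ and such that the first $k$ lateral slices of $\widetilde{\mathcal{P}}_m$ and $\widetilde{\mathcal{Q}}_m$ are the same as those of $\widetilde{\mathcal{P}}_{k+1}$ and $\widetilde{\mathcal{Q}}_{k+1}$, respectively.
   Context: Third-order real tensors $\mathcal{A}\in\mathbb{R}^{\ell\times p\times n}$ have frontal slices $\mathcal{A}^{(k)}=\mathcal{A}(:,:,k)$. Elements of $\mathbb{R}^{\ell\times 1\times n}$ are called lateral slices and elements of $\mathbb{R}^{1\times1\times n}$ are called tubes. $\widehat{\mathcal{A}}$ denotes the tensor obtained by applying the (unnormalized) discrete Fourier transform of length $n$ to each tube $\mathcal{A}(i,j,:)$. The t-product $\mathcal{C}=\mathcal{A}\star\mathcal{B}$ of $\mathcal{A}\in\mathbb{R}^{\ell\times q\times n}$ and $\mathcal{B}\in\mathbb{R}^{q\times p\times n}$ is the tensor in $\mathbb{R}^{\ell\times p\times n}$ with $\widehat{\mathcal{C}}^{(i)}=\widehat{\mathcal{A}}^{(i)}\widehat{\mathcal{B}}^{(i)}$, $i=1,\dots,n$. The product of a tensor and a tube $\bm b$ multiplies each $\widehat{\mathcal{A}}^{(i)}$ by the scalar $\widehat{\bm b}^{(i)}$, and $\bm b\star\mathcal{A}=\mathcal{A}\star\bm b$. The transpose $\mathcal{A}^H$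 is obtained by transposing all frontal slices and reversing the order of slices $2,\dots,n$ (so the frontal slices of $\widehat{\mathcal{A}^H}$ are the conjugate transposes of those of $\widehat{\mathcal{A}}$). The identity tensor $\mathcal{I}_m$ has first frontal slice $I_m$ and the others zero. $\vec{\mathcal{E}}_j\in\mathbb{R}^{j\times1\times n}$ (canonical lateral slice) has all entries zero except the first entry of its $j$th tube, which is $1$. Lateral slices $\vec{\mathcal{X}},\vec{\mathcal{Y}}$ are orthogonal if $\vec{\mathcal{X}}^H\star\vec{\mathcal{Y}}=0$; a slice has unit norm iff $\vec{\mathcal{X}}^H\star\vec{\mathcal{X}}=\mathcal{I}_1$; a tensor $\mathcal{X}$ with $j$ lateral slices has orthonormal lateral slices iff $\mathcal{X}^H\star\mathcal{X}=\mathcal{I}_j$. A tensor is upper triangular if its tubes $(i,j)$ with $i>j$ vanish. A tube is nonvanishing if it is not the zero tube. Normalizing a lateral slice $\vec{\mathcal{X}}$ means writing $\vec{\mathcal{X}}=\vec{\mathcal{Y}}\star\bm a$ with $\vec{\mathcal{Y}}$ of unit norm and $\widehat{\bm a}^{(i)}=\|\widehat{\vec{\mathcal{X}}}^{(i)}\|_2$. Output of $m$ steps of tensor Lanczos bidiagonalization (run without breakdown): $\mathcal{P}_m\in\mathbb{R}^{p\times m\times n}$ and $\mathcal{Q}_m\in\mathbb{R}^{\ell\times m\times n}$ with orthonormal lateral slices, $\vec{\mathcal{R}}_m\in\mathbb{R}^{p\times1\times n}$ with $\mathcal{P}_m^H\star\vec{\mathcal{R}}_m=0$, and $\mathcal{B}_m\in\mathbb{R}^{m\times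 m\times n}$ upper bidiagonal (only the tubes $(i,i)$ and $(i,i+1)$ may be nonzero), with $\mathcal{A}\star\mathcal{P}_m=\mathcal{Q}_m\star\mathcal{B}_m$ and $\mathcal{A}^H\star\mathcal{Q}_m=\mathcal{P}_m\star\mathcal{B}_m^H+\vec{\mathcal{R}}_m\star\vec{\mathcal{E}}_m^H$. Ritz slices: let $\mathcal{B}_m=\mathcal{U}\star\mathcal{S}\star\mathcal{V}^H$ be a t-SVD of $\mathcal{B}_m$, i.e. $\mathcal{U},\mathcal{S},\mathcal{V}\in\mathbb{R}^{m\times m\times n}$, $\mathcal{U}^H\star\mathcal{U}=\mathcal{V}^H\star\mathcal{V}=\mathcal{I}_m$, and each $\widehat{\mathcal{B}}_m^{(i)}=\widehat{\mathcal{U}}^{(i)}\widehat{\mathcal{S}}^{(i)}(\widehat{\mathcal{V}}^{(i)})^H$ is a matrix SVD with nonnegative diagonal entries in nonincreasing order. With $\vec{\mathcal{U}}_i,\vec{\mathcal{V}}_i$ the $i$th lateral slices of $\mathcal{U},\mathcal{V}$, set $\bm s^{\mathcal{A}}_{i,m}=\mathcal{S}(i,i,:)$, $\vec{\mathcal{U}}^{\mathcal{A}}_{i,m}=\mathcal{Q}_m\star\vec{\mathcal{U}}_i$, $\vec{\mathcal{V}}^{\mathcal{A}}_{i,m}=\mathcal{P}_m\star\vec{\mathcal{V}}_i$. Ritz-augmented decomposition (for $1\le k<m$): $\widetilde{\mathcal{P}}_{k+1}=[\vec{\mathcal{V}}^{\mathcal{A}}_{1,m},\dots,\vec{\mathcal{V}}^{\mathcal{A}}_{k,m},\vec{\mathcal{P}}_{m+1}]\in\mathbb{R}^{p\times(k+1)\times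 n}$ with orthonormal lateral slices, where $\vec{\mathcal{R}}_m=\vec{\mathcal{P}}_{m+1}\star\bm{\beta}_m$ is a normalization of $\vec{\mathcal{R}}_m$; $\widetilde{\mathcal{Q}}_{k+1}=[\vec{\mathcal{U}}^{\mathcal{A}}_{1,m},\dots,\vec{\mathcal{U}}^{\mathcal{A}}_{k,m},\vec{\widetilde{\mathcal{R}}}{}'_k]\in\mathbb{R}^{\ell\times(k+1)\times n}$ with orthonormal lateral slices; $\widetilde{\mathcal{B}}_{k+1}\in\mathbb{R}^{(k+1)\times(k+1)\times n}$ is the upper triangular tensor with diagonal tubes $\bm s^{\mathcal{A}}_{1,m},\dots,\bm s^{\mathcal{A}}_{k,m},\widetilde{\bm{\alpha}}_{k+1}$, with tubes $\bm{\rho}_1,\dots,\bm{\rho}_k$ above the diagonal in the last lateral slice, and all other tubes zero, where $\bm{\rho}_i=(\vec{\mathcal{U}}^{\mathcal{A}}_{i,m})^H\star\mathcal{A}\star\vec{\mathcal{P}}_{m+1}$ and $\mathcal{A}\star\vec{\mathcal{P}}_{m+1}-\sum_{i=1}^k\bm{\rho}_i\star\vec{\mathcal{U}}^{\mathcal{A}}_{i,m}=\vec{\widetilde{\mathcal{R}}}{}'_k\star\widetilde{\bm{\alpha}}_{k+1}$ is a normalization of the left-hand side. Finally, the unit-norm lateral slice $\vec{\widetilde{\mathcal{P}}}_{k+2}\in\mathbb{R}^{p\times1\times n}$, which is orthogonal to $\widetilde{\mathcal{P}}_{k+1}$, and the tube $\widetilde{\bm{\beta}}_{k+1}$ are given by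 the normalization $\mathcal{A}^H\star\vec{\widetilde{\mathcal{R}}}{}'_k-\widetilde{\bm{\alpha}}_{k+1}\star\vec{\mathcal{P}}_{m+1}=\widetilde{\bm{\beta}}_{k+1}\star\vec{\widetilde{\mathcal{P}}}_{k+2}$. *)

(* Defs.v *)
From mathcomp Require Import all_boot all_order all_algebra.
From mathcomp Require Import ring complex.
From mathcomp Require Import all_classical all_reals all_analysis.

Set Implicit Arguments.
Unset Strict Implicit.
Unset Printing Implicit Defensive.

Import Order.TTheory GRing.Theory Num.Theory.
Local Open Scope ring_scope.
Local Open Scope complex_scope.
Local Open Scope sesquilinear_scope.

(* A k is the frontal slice A(:,:,k); slices, rows and columns are numbered
   from 0. *)
Definition tensor (T : Type) (l p n : nat) : Type :=
  {ffun 'I_n -> 'M[T]_(l, p)}.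

Section Tensors.
Variable R : realType.
Local Notation C := R[i].
Local Notation tens := (tensor R).

(* exp(-2 pi i / n) *)
Definition dft_root (n : nat) : C :=
  cos (2 * pi / n%:R) -i* sin (2 * pi / n%:R).

Definition dft l p n (A : tens l p n) : tensor C l p n :=
  [ffun k : 'I_n =>
     \sum_(j < n) dft_root n ^+ (j * k) *: map_mx (real_complex R) (A j)].

(* The real part only serves to land in real tensors: the inverse transforms
   taken below are real (see dft_tprod and dft_tscale). *)
Definition idft l p n (F : tensor C l p n) : tens l p n :=
  [ffun j : 'I_n =>
     map_mx (@complex.Re R)
       (n%:R^-1 *: \sum_(k < n) dft_root n ^- (j * k) *: F k)].

Definition tprod l q p n (A : tens l q n) (B : tens q p n) : tens l p n :=
  idft [ffun k => dft A k *m dft B k].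

Definition tscale l p n (b : tens 1 1 n) (A : tens l p n) : tens l p n :=
  idft [ffun k => dft b k 0 0 *: dft A k].

(* rev_ord (ord_pred k) is - k mod n: it fixes slice 0 and reverses the order
   of the other ones. *)
Definition therm l p n (A : tens l p n) : tens p l n :=
  [ffun k => (A (rev_ord (ord_pred k)))^T].

Definition tid m n : tens m m n :=
  [ffun k : 'I_n => if k == 0%N :> nat then 1%:M else 0].

(* The canonical lateral slice with index j, supported in the last of its j
   tubes. *)
Definition tcan j n : tens j 1 n :=
  [ffun k : 'I_n =>
     \col_(i < j) if (i.+1 == j) && (k == 0%N :> nat) then 1 else 0].

End Tensors.

Arguments tid R m n : clear implicits.
Arguments tcan R j n : clear implicits.

Declare Scope tensor_scope.
Delimit Scope tensor_scope with T.
Notation "A *t B" := (tprod A B)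
  (at level 40, left associativity) : tensor_scope.
Notation "b *:t A" := (tscale b A) (at level 40) : tensor_scope.
Notation "A ^H" := (therm A) (at level 8, format "A ^H") : tensor_scope.

Section TensorDecompositions.
Variable R : realType.
Local Notation C := R[i].
Local Notation tens := (tensor R).
Local Open Scope tensor_scope.

Definition lateral l p n (A : tens l p n) (j : 'I_p) : tens l 1 n :=
  [ffun k => col j (A k)].

Definition tube l p n (A : tens l p n) (i : 'I_l) (j : 'I_p) : tens 1 1 n :=
  [ffun k => (A k i j)%:M].

Definition of_laterals l p n (X : 'I_p -> tens l 1 n) : tens l p n :=
  [ffun k => \matrix_(i, j) X j k i 0].

Definition tcat l p q n (A : tens l p n) (B : tens l q n) : tens l (p + q) n :=
  [ffun k => row_mx (A k) (B k)].

Definition orthonormal_slices l p n (X : tens l p n) : Prop :=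
  X^H *t X = tid R p n.

Definition unit_norm l n (X : tens l 1 n) : Prop :=
  X^H *t X = tid R 1 n.

Definition orthogonal_to l p n (X : tens l p n) (Y : tens l 1 n) : Prop :=
  X^H *t Y = 0.

Definition upper_triangular m n (B : tens m m n) : Prop :=
  forall i j : 'I_m, (j < i)%N -> tube B i j = 0.

Definition upper_bidiagonal m n (B : tens m m n) : Prop :=
  forall i j : 'I_m, j != i :> nat -> j != i.+1 :> nat -> tube B i j = 0.

Definition norm2 l (x : 'cV[C]_l) : C := sqrtC (\sum_i `|x i 0| ^+ 2).

(* X = Y * a is a normalization of X.  On frequencies where the transform of X
   vanishes, Y is only required to have unit norm. *)
Definition normalization l n (X Y : tens l 1 n) (a : tens 1 1 n) : Prop :=
  [/\ unit_norm Y, X = a *:t Y & forall k, dft a k 0 0 = norm2 (dft X k)].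

Record lanczos_bidiag l p m n (A : tens l p n) (P : tens p m n)
    (Q : tens l m n) (B : tens m m n) (r : tens p 1 n) : Prop := {
  lanczos_P : orthonormal_slices P;
  lanczos_Q : orthonormal_slices Q;
  lanczos_r : orthogonal_to P r;
  lanczos_B : upper_bidiagonal B;
  lanczos_AP : A *t P = Q *t B;
  lanczos_AHQ : A^H *t Q = P *t B^H + r *t (tcan R m n)^H }.

Record matrix_svd m (B U S V : 'M[C]_m) : Prop := {
  svd_U : U \is unitarymx;
  svd_V : V \is unitarymx;
  svd_diag : is_diag_mx S;
  svd_ge0 : forall i, 0 <= S i i;
  svd_nonincr : forall i j : 'I_m, (i <= j)%N -> S j j <= S i i;
  svd_eq : B = U *m S *m V ^t* }.

Record tsvd m n (B U S V : tens m m n) : Prop := {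
  tsvd_U : U^H *t U = tid R m n;
  tsvd_V : V^H *t V = tid R m n;
  tsvd_eq : B = U *t S *t V^H;
  tsvd_slices : forall k, matrix_svd (dft B k) (dft U k) (dft S k) (dft V k) }.

(* The singular tube S(i,i,:), the left and the right Ritz lateral slices. *)
Definition ritz_tube m n (S : tens m m n) (i : 'I_m) : tens 1 1 n :=
  tube S i i.
Definition ritz_left l m n (Q : tens l m n) (U : tens m m n) (i : 'I_m) :
  tens l 1 n := Q *t lateral U i.
Definition ritz_right p m n (P : tens p m n) (V : tens m m n) (i : 'I_m) :
  tens p 1 n := P *t lateral V i.

(*  / diag(s_1 .. s_k)  rho  \
    \        0         alpha /  *)
Definition arrow k n (s rho : 'I_k -> tens 1 1 n) (alpha : tens 1 1 n) :
    tens (k + 1) (k + 1) n :=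
  [ffun f => block_mx (diag_mx (\row_i s i f 0 0)) (\col_i rho i f 0 0)
                      0                            (alpha f)].

(* Pt, Qt, Bt, Pnext, betat form the augmentation by k Ritz slices of the
   Lanczos output P, Q, r with respect to the t-SVD U, S, V.  Here pm1 is the
   normalization of r, with betam its norm tube, rk the normalized residual,
   with alpha its norm tube. *)
Record ritz_augmented l p m n k (km : (k < m)%N) (A : tens l p n)
    (P : tens p m n) (Q : tens l m n) (r : tens p 1 n) (U S V : tens m m n)
    (pm1 : tens p 1 n) (betam : tens 1 1 n) (rho : 'I_k -> tens 1 1 n)
    (rk : tens l 1 n) (alpha : tens 1 1 n)
    (Pt : tens p (k + 1) n) (Qt : tens l (k + 1) n)
    (Bt : tens (k + 1) (k + 1) n) (Pnext : tens p 1 n) (betat : tens 1 1 n) :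
    Prop := {
  ritz_pm1 : normalization r pm1 betam;
  ritz_Pt : Pt =
    tcat (of_laterals (fun i => ritz_right P V (widen_ord (ltnW km) i))) pm1;
  ritz_Pt_orth : orthonormal_slices Pt;
  ritz_rho : forall i : 'I_k, rho i =
    (ritz_left Q U (widen_ord (ltnW km) i))^H *t A *t pm1;
  ritz_rk : normalization
    (A *t pm1 - \sum_(i < k) rho i *:t ritz_left Q U (widen_ord (ltnW km) i))
    rk alpha;
  ritz_Qt : Qt =
    tcat (of_laterals (fun i => ritz_left Q U (widen_ord (ltnW km) i))) rk;
  ritz_Qt_orth : orthonormal_slices Qt;
  ritz_Bt : Bt =
    arrow (fun i => ritz_tube S (widen_ord (ltnW km) i)) rho alpha;
  ritz_next : normalization (A^H *t rk - alpha *:t pm1) Pnext betat;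
  ritz_next_orth : orthogonal_to Pt Pnext }.

End TensorDecompositions.

(* tprod and tscale act slicewise on transforms, and the transform is
   injective, so they are the real tensors characterized by this property. *)
Section Transforms.
Variable R : realType.
Local Notation C := R[i].
Local Notation tens := (tensor R).
Local Open Scope tensor_scope.

Lemma dft_root_exp n j : dft_root R n ^+ j =
  cos (2 * pi / n%:R *+ j) -i* sin (2 * pi / n%:R *+ j).
Proof.
rewrite /dft_root; set t := 2 * pi / _.
elim: j => [|j IH]; first by rewrite expr0 mulr0n cos0 sin0 oppr0.
rewrite exprS IH mulrS cosD sinD; apply/eqP; rewrite eq_complex /=.
by apply/andP; split; apply/eqP; ring.
Qed.

Lemma dft_root_prim n : (0 < n)%N -> n.-primitive_root (dft_root R n).
Proof.
move=> n0; have nz : n%:R != 0 :> R by rewrite pnatr_eq0 -lt0n.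
have w1 : dft_root R n ^+ n = 1.
  rewrite dft_root_exp -mulr_natr -mulrA mulVf // mulr1 mulr_natl.
  by rewrite cos2pi sin2pi oppr0.
have [m mprim mn] := prim_order_exists n0 w1.
have m0 := prim_order_gt0 mprim.
have [mEn|mNn] := eqVneq m n; first by rewrite -{1}mEn.
have ltmn : (m < n)%N by rewrite ltn_neqAle mNn dvdn_leq.
have := prim_expr_order mprim; rewrite dft_root_exp => /eqP.
rewrite eq_complex /= => /andP[/eqP + _].
set u : R := pi * (m%:R / n%:R).
have -> : 2 * pi / n%:R *+ m = u *+ 2.
  by rewrite /u -[LHS]mulr_natr -[RHS]mulr_natl -!mulrA [n%:R^-1 * _]mulrC.
rewrite cos_mulr2n => /eqP; rewrite subr_eq -(mulr2n 1) eqrMn2r /=.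
rewrite -subr_eq0 -oppr_eq0 opprB -sin2cos2 sqrf_eq0 => /eqP su.
suff : 0 < sin u by rewrite su ltxx.
have n0R : 0 < n%:R :> R by rewrite ltr0n.
apply: sin_gt0_pi; apply/andP; split.
  rewrite /u; apply: mulr_gt0; first exact: pi_gt0.
  by rewrite divr_gt0 ?ltr0n.
by rewrite /u gtr_pMr ?pi_gt0 // ltr_pdivrMr // mul1r ltr_nat.
Qed.

Lemma sum_dft_root n (a j : 'I_n) :
  \sum_(k < n) dft_root R n ^- (j * k) * dft_root R n ^+ (a * k) =
  if a == j then n%:R else 0.
Proof.
have n0 : (0 < n)%N by apply: leq_ltn_trans (ltn_ord j).
have wp := dft_root_prim n0; set w := dft_root R n in wp *.
have wj : w ^+ j != 0.
  by rewrite expf_eq0 (prim_root_eq0 wp) eqn0Ngt n0 andbF.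
pose z := w ^+ a / w ^+ j.
rewrite (eq_bigr (fun k : 'I_n => z ^+ k)); last first.
  by move=> k _; rewrite !exprM expr_div_n mulrC.
have [aEj|aj] := eqVneq a j.
  by rewrite (eq_bigr (fun=> 1)) ?sumr_const ?card_ord // => k _;
    rewrite /z aEj divff ?expr1n.
have z1 : z != 1.
  apply: contra aj => /eqP zE; have : w ^+ a == w ^+ j.
    by rewrite -[X in _ == X]mul1r -zE /z divfK.
  by rewrite (eq_prim_root_expr wp) !modn_small.
have /eqP := subrX1 z n.
have -> : z ^+ n - 1 = 0.
  rewrite /z expr_div_n -!exprM ![(_ * n)%N]mulnC !exprM (prim_expr_order wp).
  by rewrite !expr1n divr1 subrr.
by rewrite eq_sym mulf_eq0 subr_eq0 (negPf z1) => /eqP.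
Qed.

Lemma dftK l p n : cancel (@dft R l p n) (@idft R l p n).
Proof.
move=> A; apply/ffunP => j; rewrite !ffunE.
have n0 : (0 < n)%N by apply: leq_ltn_trans (ltn_ord j).
under eq_bigr do rewrite ffunE scaler_sumr.
rewrite exchange_big /= (bigD1 j) //= [X in _ + X]big1 ?addr0.
  under eq_bigr do rewrite scalerA.
  rewrite -scaler_suml sum_dft_root eqxx scalerA mulVf ?pnatr_eq0 -?lt0n //.
  by rewrite scale1r; apply/matrixP => x y; rewrite !mxE.
move=> a aj; under eq_bigr do rewrite scalerA.
by rewrite -scaler_suml sum_dft_root (negPf aj) scale0r.
Qed.

Lemma dft_inj l p n : injective (@dft R l p n).
Proof. exact: can_inj (@dftK l p n). Qed.

Lemma dft_tprod l q p n (A : tens l q n) (B : tens q p n) k :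
  dft (A *t B) k = dft A k *m dft B k.
Proof.
case: n => [|n] in A B k *; first by case: k.
pose D : tens l p n.+1 := [ffun c => \sum_a A a *m B (c - a)].
have DE i : dft D i = dft A i *m dft B i.
  have wp := @dft_root_prim n.+1 isT.
  rewrite !ffunE mulmx_suml.
  under eq_bigr do rewrite ffunE raddf_sum /= scaler_sumr.
  rewrite exchange_big /=; apply: eq_bigr => a _.
  rewrite mulmx_sumr (reindex_inj (addrI a)) /=; apply: eq_bigr => b _.
  have -> : a + b - a = b by rewrite [a + b]addrC addrK.
  rewrite map_mxM -scalemxAl -scalemxAr scalerA -exprD.
  congr (_ *: _); apply/eqP; rewrite (eq_prim_root_expr wp).
  by rewrite -mulnDl modnMml.
suff -> : A *t B = D by [].
rewrite /tprod -[RHS]dftK.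
have -> : [ffun i => dft A i *m dft B i] = dft D => //.
by apply/ffunP => i; rewrite DE ffunE.
Qed.

Lemma dft_tscale l p n (b : tens 1 1 n) (A : tens l p n) k :
  dft (b *:t A) k = dft b k 0 0 *: dft A k.
Proof.
pose D : tens l l n := [ffun i => (b i 0 0)%:M].
have DE i : dft D i = (dft b i 0 0)%:M.
  rewrite !ffunE summxE raddf_sum /=; apply: eq_bigr => j _.
  by rewrite ffunE; apply/matrixP => x y; rewrite !mxE rmorphMn /= mulrnAr.
suff -> : b *:t A = D *t A by rewrite dft_tprod DE mul_scalar_mx.
rewrite /tscale /tprod.
have -> : [ffun i => dft b i 0 0 *: dft A i] = [ffun i => dft D i *m dft A i].
  by apply/ffunP => i; rewrite [LHS]ffunE [RHS]ffunE DE mul_scalar_mx.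
by [].
Qed.

Lemma dft_therm l p n (A : tens l p n) k : dft A^H k = (dft A k) ^t*.
Proof.
have n0 : (0 < n)%N by apply: leq_ltn_trans (ltn_ord k).
have wp := dft_root_prim n0; set w := dft_root R n in wp *.
have wJ : w * w^* = 1.
  apply/eqP; rewrite /w /dft_root eq_complex /=.
  apply/andP; split; apply/eqP; last by ring.
  by rewrite -[RHS](cos2Dsin2 (2 * pi / n%:R)); ring.
pose h (j : 'I_n) := rev_ord (ord_pred j).
have hm (j : 'I_n) : (h j + j = 0 %[mod n])%N.
  rewrite /h /=; have := ltn_ord j; case: (val j) => [|i] i_n.
    by rewrite add0n addn0 (@modn_small n.-1) ?ltn_predL // prednK // subnn.
  by rewrite addSn /= modnDr (modn_small (ltnW i_n)) subnK ?modnn ?mod0n // ltnW.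
have hh : involutive h.
  move=> j; apply: val_inj; have := hm (h j).
  rewrite -(hm j) addnC => /eqP; rewrite eqn_modDl => /eqP.
  by rewrite !modn_small ?ltn_ord.
rewrite !ffunE (reindex_inj (inv_inj hh)) /= raddf_sum /= map_mx_sum.
apply: eq_bigr => j _; rewrite ffunE -/(h _) hh.
have -> : w ^+ (h j * k) = (w ^+ (j * k))^*.
  rewrite rmorphXn /=; apply: (@mulfI _ (w ^+ (j * k))).
    by rewrite expf_eq0 (prim_root_eq0 wp) eqn0Ngt n0 andbF.
  rewrite -exprMn wJ expr1n -exprD -mulnDl addnC.
  by rewrite -(prim_expr_mod wp) -modnMml hm mod0n mul0n mod0n.
apply/matrixP => x y; rewrite !mxE -[RHS]/(conjc _) rmorphM; congr (_ * _).
by apply/eqP; rewrite eq_complex /= oppr0 !eqxx.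
Qed.
End Transforms.

(* Main.v *)
(* The augmented decomposition is extended one lateral slice at a time, from
   k + 1 to m, by the Lanczos recurrence.  If w is the residual of the first j
   slices, the new right direction v is its normalization, and the relation for
   A^H gives Q^H A v = e_j (w^H v), so that A v - Q (e_j (w^H v)) is orthogonal
   to Q; its normalization is the new left direction q, and the residual of
   A^H q lies orthogonal to [P v].  A nonzero tube may still vanish at some
   frequencies; there an arbitrary unit direction orthogonal to the previous
   ones will do (it exists since j < min(l, p)), provided that it is chosen
   compatibly with complex conjugation, so that the inverse transform is a real
   tensor. *)

Require Import Defs.
From HB Require Import structures.
From mathcomp Require Import all_boot all_order all_algebra.
From mathcomp Require Import ring complex.
From mathcomp Require Import all_classical all_reals all_analysis.

Set Implicit Arguments.
Unset Strict Implicit.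
Unset Printing Implicit Defensive.

Import Order.TTheory GRing.Theory Num.Theory.
Local Open Scope ring_scope.
Local Open Scope tensor_scope.
Local Open Scope sesquilinear_scope.
Local Notation conj := (map_mx Num.conj).

(** * Conjugate transposes, normalization and orthonormal completion of complex columns *)

Section ConjugateTranspose.
Variable C : numClosedFieldType.

Lemma adjmxM l q p (X : 'M[C]_(l, q)) (Y : 'M[C]_(q, p)) :
  (X *m Y) ^t* = Y ^t* *m X ^t*.
Proof. by rewrite trmx_mul map_mxM. Qed.

Lemma adjmxD l q (X Y : 'M[C]_(l, q)) : (X + Y) ^t* = X ^t* + Y ^t*.
Proof. by rewrite linearD map_mxD. Qed.

Lemma adjmxZ l q a (X : 'M[C]_(l, q)) : (a *: X) ^t* = a^* *: X ^t*.
Proof. by apply/matrixP => i j; rewrite !mxE rmorphM. Qed.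

Lemma adjmx0 l q : (0 : 'M[C]_(l, q)) ^t* = 0.
Proof. by rewrite trmx0 map_mx0. Qed.

Lemma adjmx_row l p q (X : 'M[C]_(l, p)) (Y : 'M[C]_(l, q)) :
  (row_mx X Y) ^t* = col_mx (X ^t*) (Y ^t*).
Proof. by rewrite tr_row_mx map_col_mx. Qed.

Lemma adjmx_block l1 l2 p1 p2 (X : 'M[C]_(l1, p1)) (Y : 'M[C]_(l1, p2))
    (Z : 'M[C]_(l2, p1)) (T : 'M[C]_(l2, p2)) :
  (block_mx X Y Z T) ^t* = block_mx (X ^t*) (Z ^t*) (Y ^t*) (T ^t*).
Proof. by rewrite tr_block_mx map_block_mx. Qed.

Lemma conjmx_adj l q (X : 'M[C]_(l, q)) : (conj X) ^t* = conj (X ^t*).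
Proof. by rewrite map_trmx. Qed.

Lemma adjmx_mulE l (v : 'cV[C]_l) :
  v ^t* *m v = (\sum_i `|v i 0| ^+ 2)%:M.
Proof.
rewrite [LHS]mx11_scalar; congr (_%:M); rewrite mxE; apply: eq_bigr => i _.
by rewrite !mxE normCKC.
Qed.

Lemma adjmx_mul_gt0 l (v : 'cV[C]_l) :
  v != 0 -> 0 < \sum_i `|v i 0| ^+ 2.
Proof.
move=> vN0; rewrite lt0r sumr_ge0 ?andbT; last by move=> i _; rewrite exprn_ge0.
apply: contra vN0 => /eqP v0; apply/eqP/colP => i; rewrite mxE; apply/eqP.
rewrite -normr_eq0 -sqrf_eq0; apply/eqP.
by apply: (psumr_eq0P _ v0) => // j _; rewrite exprn_ge0.
Qed.

(** The inverse of zero is zero, so the zero column is sent to itself. *)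
Definition normalize l (v : 'cV[C]_l) : 'cV[C]_l :=
  (sqrtC (\sum_i `|v i 0| ^+ 2))^-1 *: v.

Lemma normalize_unit l (v : 'cV[C]_l) :
  v != 0 -> (normalize v) ^t* *m normalize v = 1%:M.
Proof.
move=> /adjmx_mul_gt0; rewrite /normalize; set s := \sum_i _ => s_gt0.
rewrite adjmxZ -scalemxAl -scalemxAr adjmx_mulE -/s scalerA.
rewrite scale_scalar_mx geC0_conj ?invr_ge0 ?sqrtC_ge0 ?ltW //.
by rewrite -invfM -expr2 sqrtCK mulVf ?gt_eqF.
Qed.

Lemma normalizeE l (v : 'cV[C]_l) :
  v != 0 -> exists s, v = s *: normalize v.
Proof.
move=> /adjmx_mul_gt0 v_gt0; exists (sqrtC (\sum_i `|v i 0| ^+ 2)).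
by rewrite scalerA mulfV ?scale1r // sqrtC_eq0 gt_eqF.
Qed.

Lemma normalize_conj l (v : 'cV[C]_l) :
  normalize (conj v) = conj (normalize v).
Proof.
rewrite /normalize map_mxZ.
under eq_bigr => i _ do rewrite mxE norm_conjC.
congr (_ *: _); apply/esym/geC0_conj; rewrite invr_ge0 sqrtC_ge0.
by apply: sumr_ge0 => i _; rewrite exprn_ge0.
Qed.

(* For [y = 0], the normalized first nonzero column of the projector
   [1 - X X^*]: unlike an arbitrary completion, this choice commutes with
   complex conjugation. *)
Definition completion l j (X : 'M[C]_(l, j)) (y : 'cV[C]_l) : 'cV[C]_l :=
  let E := 1%:M - X *m X ^t* in
  normalize (if y != 0 then y
             else if [pick i | col i E != 0] is Some i then col i E else 0).

(** Conjugating [X] conjugates the projector, whose conjugate has its nonzero columns at the same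
    indices, so [pick] returns the same index on both sides. *)
Lemma completion_conj l j (X : 'M[C]_(l, j)) (y : 'cV[C]_l) :
  completion (conj X) (conj y) = conj (completion X y).
Proof.
rewrite /completion -normalize_conj; congr normalize.
rewrite map_mx_eq0; case: ifP => // _.
have -> : 1%:M - conj X *m (conj X) ^t* =
          conj (1%:M - X *m X ^t*).
  by rewrite map_mxB map_mx1 map_mxM conjmx_adj.
set E := 1%:M - _.
have -> : [pick i | col i (conj E) != 0] = [pick i | col i E != 0].
  by apply: eq_pick => i /=; rewrite -map_col map_mx_eq0.
by case: pickP => [i _|_]; rewrite ?map_col ?map_mx0.
Qed.

(** A nonzero [y] is already orthogonal to [X] and only has to be normalized. For [y = 0] the last
    equation is trivial, and the columns of [E] are orthogonal to [X] since [X ^t* *m E = 0]; one of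
    them is nonzero because [j < l]. *)
Lemma completionP l j (X : 'M[C]_(l, j)) (y : 'cV[C]_l) :
    (j < l)%N -> X ^t* *m X = 1%:M -> X ^t* *m y = 0 ->
  let q := completion X y in
  [/\ q ^t* *m q = 1%:M, X ^t* *m q = 0 & y = q *m (q ^t* *m y)].
Proof.
move=> jl XX Xy; rewrite /completion /=; set E := 1%:M - _.
have XE : X ^t* *m E = 0 by rewrite mulmxBr mulmx1 mulmxA XX mul1mx subrr.
case: (eqVneq y 0) => [->|yN0] /=; last first.
  have nn := normalize_unit yN0; split=> //.
    by rewrite /normalize -scalemxAr Xy scaler0.
  have [s yE] := normalizeE yN0.
  by move: (normalize y) nn yE => v vv ->; rewrite -!scalemxAr vv mulmx1.
case: pickP => [i iE|E0].
  split; [exact: normalize_unit| |by rewrite !mulmx0].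
  by rewrite /normalize -scalemxAr colE mulmxA XE mul0mx scaler0.
(* If [E] vanished, the identity of rank [l] would factor through dimension [j < l]. *)
suff /eqP E_0 : E == 0.
  have : (\rank (1%:M : 'M[C]_l) <= j)%N.
    by move/eqP: E_0; rewrite subr_eq0 => /eqP ->; exact: mulmx_max_rank.
  by rewrite mxrank1 leqNgt jl.
apply/eqP/matrixP => a i; have /negbFE/eqP/colP/(_ a) := E0 i.
by rewrite !mxE.
Qed.

End ConjugateTranspose.

(* A sealed transform: on a failed match, unification would unfold [dft]. *)
HB.lock Definition hat (R : realType) l p n (A : tensor R l p n) (k : 'I_n) :
  'M[R[i]]_(l, p) := dft A k.

(** * Conjugate symmetry as the characterization of transforms of real tensors *)

Section RealTransforms.
Variable R : realType.
Local Notation C := R[i].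

(** The frequency [- k] modulo [n], in the form used by [therm]. *)
Definition freq_opp n (k : 'I_n) : 'I_n := rev_ord (ord_pred k).

Lemma freq_oppD n (k : 'I_n) : (freq_opp k + k = 0 %[mod n])%N.
Proof.
rewrite /freq_opp /=; have := ltn_ord k; case: (val k) => [|i] i_n.
  by rewrite add0n addn0 (@modn_small n.-1) ?ltn_predL // prednK // subnn.
by rewrite addSn /= modnDr (modn_small (ltnW i_n)) subnK ?modnn ?mod0n // ltnW.
Qed.

Lemma freq_oppK n : involutive (@freq_opp n).
Proof.
move=> k; apply: val_inj; have := freq_oppD (freq_opp k).
rewrite -(freq_oppD k) addnC => /eqP; rewrite eqn_modDl => /eqP.
by rewrite !modn_small ?ltn_ord.
Qed.

Lemma dft_root_neq0 n : (0 < n)%N -> dft_root R n != 0.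
Proof.
by move=> n_gt0; rewrite (prim_root_eq0 (dft_root_prim R n_gt0)) -lt0n.
Qed.

Lemma conj_dft_root n : (0 < n)%N -> (dft_root R n)^* = (dft_root R n)^-1.
Proof.
move=> n_gt0; apply: (mulfI (dft_root_neq0 n_gt0)).
rewrite mulfV ?dft_root_neq0 //; apply/eqP; rewrite /dft_root eq_complex /=.
apply/andP; split; apply/eqP; last by ring.
by rewrite -[RHS](cos2Dsin2 (2 * pi / n%:R)); ring.
Qed.

Lemma conj_dft_rootX n j : (0 < n)%N ->
  (dft_root R n ^+ j)^* = dft_root R n ^- j.
Proof. by move=> n_gt0; rewrite rmorphXn /= conj_dft_root // exprVn. Qed.

Lemma dft_root_opp n j (k : 'I_n) :
  dft_root R n ^+ (j * freq_opp k) = dft_root R n ^- (j * k).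
Proof.
have n_gt0 : (0 < n)%N by apply: leq_ltn_trans (ltn_ord k).
apply: (mulIf (expf_neq0 (j * k) (dft_root_neq0 n_gt0))).
rewrite mulVf ?expf_neq0 ?dft_root_neq0 // -exprD -mulnDr.
rewrite -(prim_expr_mod (dft_root_prim R n_gt0)) -modnMmr freq_oppD mod0n.
by rewrite muln0 mod0n.
Qed.

(** The slices of [A] are real and the root has modulus one, so negating the frequency conjugates
    every term of the sum. *)
Lemma dft_freq_opp l p n (A : tensor R l p n) (k : 'I_n) :
  dft A (freq_opp k) = conj (dft A k).
Proof.
have n_gt0 : (0 < n)%N by apply: leq_ltn_trans (ltn_ord k).
rewrite !ffunE map_mx_sum; apply: eq_bigr => j _.
have wE := conj_dft_rootX (j * k) n_gt0.
rewrite map_mxZ dft_root_opp -wE; congr (_ *: _).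
apply/matrixP => x y; rewrite !mxE.
by apply/eqP; rewrite eq_complex /= oppr0 !eqxx.
Qed.

(** Conjugate symmetry makes the inverse sums real, so the real part taken by [idft] loses nothing
    and Fourier inversion applies. This is what allows real tensors to be built frequency by
    frequency. *)
Lemma idftK l p n (F : tensor C l p n) :
  (forall k, F (freq_opp k) = conj (F k)) -> dft (idft F) = F.
Proof.
move=> Freal; apply/ffunP => k; rewrite ffunE.
have n_gt0 : (0 < n)%N by apply: leq_ltn_trans (ltn_ord k).
pose G (j : 'I_n) := n%:R^-1 *: \sum_(i < n) dft_root R n ^- (j * i) *: F i.
have Greal j : conj (G j) = G j.
  rewrite /G map_mxZ fmorphV rmorph_nat map_mx_sum; congr (_ *: _).
  (* Conjugation exchanges the terms of opposite frequencies. *)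
  rewrite (reindex_inj (inv_inj (@freq_oppK n))) /=; apply: eq_bigr => i _.
  rewrite map_mxZ -Freal freq_oppK fmorphV /= conj_dft_rootX // invrK.
  by rewrite dft_root_opp.
have GE j : map_mx (real_complex R) (idft F j) = G j.
  rewrite ffunE -/(G j); have := Greal j; move: (G j) => M /matrixP MR.
  apply/matrixP => x y; have := MR x y; rewrite !mxE.
  case: (M x y) => [a b] /eqP; rewrite eq_complex /= => /andP[_ /eqP bN].
  have -> // : b = 0.
  by apply/eqP; rewrite -eqNr bN.
under eq_bigr do rewrite GE /G scalerA mulrC -scalerA scaler_sumr.
(* By orthogonality of the powers of the root, only the frequency [k] survives, with weight [n]. *)
rewrite -scaler_sumr exchange_big /= (bigD1 k) //= [X in _ + X]big1 ?addr0.
  under eq_bigr do rewrite scalerA mulrC ![(_ * k)%N]mulnC.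
  rewrite -scaler_suml sum_dft_root eqxx scalerA mulVf ?pnatr_eq0 -?lt0n //.
  by rewrite scale1r.
move=> i ik.
under eq_bigr do rewrite scalerA mulrC [(_ * k)%N]mulnC [(_ * i)%N]mulnC.
by rewrite -scaler_suml sum_dft_root eq_sym (negPf ik) scale0r.
Qed.

(** * Tensor operations and predicates read at each frequency *)

Lemma hatE l p n (A : tensor R l p n) k : hat A k = dft A k.
Proof. by rewrite hat.unlock. Qed.

Lemma hat_tprod l q p n (A : tensor R l q n) (B : tensor R q p n) k :
  hat (A *t B) k = hat A k *m hat B k.
Proof. by rewrite !hatE; exact: dft_tprod. Qed.

Lemma hat_therm l p n (A : tensor R l p n) k : hat A^H k = (hat A k) ^t*.
Proof. by rewrite !hatE; exact: dft_therm. Qed.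

Lemma hat_tscale l p n (b : tensor R 1 1 n) (A : tensor R l p n) k :
  hat (b *:t A) k = hat b k 0 0 *: hat A k.
Proof. by rewrite !hatE; exact: dft_tscale. Qed.

Lemma hat_freq_opp l p n (A : tensor R l p n) k :
  hat A (freq_opp k) = conj (hat A k).
Proof. by rewrite !hatE; exact: dft_freq_opp. Qed.

Lemma hatD l p n (A B : tensor R l p n) k : hat (A + B) k = hat A k + hat B k.
Proof.
rewrite !hatE !ffunE -big_split; apply: eq_bigr => j _ /=.
by rewrite ffunE map_mxD scalerDr.
Qed.

Lemma hat0 l p n k : hat (0 : tensor R l p n) k = 0.
Proof.
by rewrite hatE ffunE big1 // => j _; rewrite ffunE map_mx0 scaler0.
Qed.

Lemma hatB l p n (A B : tensor R l p n) k : hat (A - B) k = hat A k - hat B k.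
Proof.
rewrite !hatE !ffunE -sumrB; apply: eq_bigr => j _ /=.
by rewrite !ffunE map_mxB scalerBr.
Qed.

Lemma hat_tid m n k : hat (tid R m n) k = 1%:M.
Proof.
have n_gt0 : (0 < n)%N by apply: leq_ltn_trans (ltn_ord k).
rewrite hatE ffunE (bigD1 (Ordinal n_gt0)) //= big1 ?addr0.
  by rewrite mul0n expr0 scale1r ffunE /= map_mx1.
by move=> j j0; rewrite ffunE ifN ?map_mx0 ?scaler0.
Qed.

Lemma hat_tcan j n k :
  hat (tcan R j n) k = \col_(i < j) (i.+1 == j)%:R.
Proof.
have n_gt0 : (0 < n)%N by apply: leq_ltn_trans (ltn_ord k).
rewrite hatE ffunE (bigD1 (Ordinal n_gt0)) //= big1 ?addr0.
  rewrite mul0n expr0 scale1r ffunE /=; apply/colP => i.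
  by rewrite !mxE andbT; case: ifP; rewrite ?rmorph1 ?rmorph0.
move=> i i0; rewrite ffunE; apply/colP => x; rewrite !mxE.
by rewrite [X in _ && X](negPf i0) andbF rmorph0 mulr0.
Qed.

Lemma hat_tcat l p q n (A : tensor R l p n) (B : tensor R l q n) k :
  hat (tcat A B) k = row_mx (hat A k) (hat B k).
Proof.
rewrite !hatE !ffunE; apply: (big_rec3 (fun a b c => c = row_mx a b)).
  by rewrite row_mx0.
move=> j a b _ _ ->.
by rewrite ffunE map_row_mx scale_row_mx add_row_mx.
Qed.

Lemma hat_block m1 m2 p1 p2 n (A : tensor R m1 p1 n) (B : tensor R m1 p2 n)
    (D : tensor R m2 p2 n) k :
  hat [ffun f => block_mx (A f) (B f) 0 (D f)] k =
  block_mx (hat A k) (hat B k) 0 (hat D k).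
Proof.
(* The zero block is read as the transform of a zero tensor, so that both block rows become
   transforms of concatenations. *)
rewrite /block_mx -(hat0 m2 p1 k) -!hat_tcat !hatE !ffunE.
apply: (big_rec3 (fun a b c => c = col_mx a b)); first by rewrite col_mx0.
move=> j a b _ _ ->.
by rewrite !ffunE map_col_mx scale_col_mx add_col_mx.
Qed.

Lemma hat_tube l p n (A : tensor R l p n) i j k :
  hat (tube A i j) k = (hat A k i j)%:M.
Proof.
rewrite !hatE !ffunE summxE raddf_sum /=; apply: eq_bigr => f _.
by rewrite ffunE; apply/matrixP => x y; rewrite !mxE rmorphMn /= mulrnAr.
Qed.

Lemma hat_eqP l p n (A B : tensor R l p n) :
  A = B <-> forall k, hat A k = hat B k.
Proof. by split=> [->|AB] //; apply/dft_inj/ffunP => k; rewrite -!hatE. Qed.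

Lemma orthonormal_slicesP l j n (X : tensor R l j n) :
  orthonormal_slices X <-> forall k, (hat X k) ^t* *m hat X k = 1%:M.
Proof.
by split=> [/hat_eqP E k|E]; [|apply/hat_eqP => k];
  have := E k; rewrite hat_tprod hat_therm hat_tid.
Qed.

Lemma orthogonal_toP l j n (X : tensor R l j n) (Y : tensor R l 1 n) :
  orthogonal_to X Y <-> forall k, (hat X k) ^t* *m hat Y k = 0.
Proof.
by split=> [/hat_eqP E k|E]; [|apply/hat_eqP => k];
  have := E k; rewrite hat_tprod hat_therm hat0.
Qed.

(* The next proofs give terms instead of rewriting, as unification takes long
   to tell two products apart. *)
Lemma tprod_eqP l p q j n (A : tensor R l p n) (P : tensor R p j n)
    (Q : tensor R l q n) (B : tensor R q j n) :
  A *t P = Q *t B <->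
  forall k, hat A k *m hat P k = hat Q k *m hat B k.
Proof.
split=> [E k|E].
  exact: (etrans (esym (hat_tprod A P k))
    (etrans (congr1 (fun X => hat X k) E) (hat_tprod Q B k))).
apply/hat_eqP => k.
exact: (etrans (hat_tprod A P k) (etrans (E k) (esym (hat_tprod Q B k)))).
Qed.

Lemma hat_tprodB l p q j n (A : tensor R l p n) (P : tensor R p j n)
    (Q : tensor R l q n) (B : tensor R q j n) k :
  hat (A *t P - Q *t B) k = hat A k *m hat P k - hat Q k *m hat B k.
Proof.
exact: (etrans (hatB _ _ k)
  (f_equal2 (fun X Y => X - Y) (hat_tprod A P k) (hat_tprod Q B k))).
Qed.

Lemma hat_tprodD l p q j n (A : tensor R l p n) (P : tensor R p j n)
    (Q : tensor R l q n) (B : tensor R q j n) k :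
  hat (A *t P + Q *t B) k = hat A k *m hat P k + hat Q k *m hat B k.
Proof.
exact: (etrans (hatD _ _ k) (f_equal2 +%R (hat_tprod A P k) (hat_tprod Q B k))).
Qed.

Lemma tprod_therm_eqP l p q j i n (A : tensor R l p n) (Q : tensor R l q n)
    (P : tensor R p j n) (B : tensor R q j n) (w : tensor R p i n)
    (e : tensor R q i n) :
  A^H *t Q = P *t B^H + w *t e^H <->
  forall k, (hat A k) ^t* *m hat Q k =
    hat P k *m (hat B k) ^t* + hat w k *m (hat e k) ^t*.
Proof.
have lE k : hat (A^H *t Q) k = (hat A k) ^t* *m hat Q k.
  by rewrite hat_tprod hat_therm.
have rE k : hat (P *t B^H + w *t e^H) k =
    hat P k *m (hat B k) ^t* + hat w k *m (hat e k) ^t*.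
  by rewrite hat_tprodD !hat_therm.
split=> [E k|E].
  exact: (etrans (esym (lE k)) (etrans (congr1 (fun X => hat X k) E) (rE k))).
by apply/hat_eqP => k; exact: (etrans (lE k) (etrans (E k) (esym (rE k)))).
Qed.

Lemma upper_triangularP m n (B : tensor R m m n) :
  upper_triangular B <->
  forall k (i j : 'I_m), (j < i)%N -> hat B k i j = 0.
Proof.
split=> E.
  move=> k i j ji; have /hat_eqP/(_ k) := E i j ji.
  by rewrite hat_tube hat0 => /matrixP/(_ 0 0); rewrite !mxE.
move=> i j ji; apply/hat_eqP => k; rewrite hat_tube hat0 E //.
by rewrite raddf0.
Qed.

Lemma lateral_tcatl l p q n (A : tensor R l p n) (B : tensor R l q n) i :
  lateral (tcat A B) (lshift q i) = lateral A i.
Proof. by apply/ffunP => k; rewrite !ffunE colKl. Qed.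

(** [completion] is applied at each frequency, including those where [y] vanishes; as it commutes
    with conjugation, the result is the transform of a real slice. *)
Lemma orthonormal_completion l j n (X : tensor R l j n) (y : tensor R l 1 n) :
    (j < l)%N -> orthonormal_slices X -> orthogonal_to X y ->
  exists q : tensor R l 1 n,
    [/\ orthonormal_slices q, orthogonal_to X q & y = q *t (q^H *t y)].
Proof.
move=> jl /orthonormal_slicesP XX /orthogonal_toP Xy.
pose F : tensor C l 1 n := [ffun k => completion (hat X k) (hat y k)].
have FE k : F k = completion (hat X k) (hat y k) by exact: ffunE.
have qE k : hat (idft F) k = completion (hat X k) (hat y k).
  rewrite hatE idftK ?FE // => f.
  by rewrite !FE !hat_freq_opp completion_conj.
move: (idft F) qE => q qE; have cP k := completionP jl (XX k) (Xy k).
exists q; split.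
- by apply/orthonormal_slicesP => k; rewrite qE; case: (cP k).
- by apply/orthogonal_toP => k; rewrite qE; case: (cP k).
by apply/hat_eqP => k; rewrite !hat_tprod hat_therm qE; case: (cP k).
Qed.

End RealTransforms.

(** * One step of the recurrence for complex matrices *)

Section Extension.
Variable C : numClosedFieldType.

(** The adjoint of the second relation, applied to [v], loses its term in [P] and leaves exactly the
    coefficients [e *m (w ^t* *m v)] that are subtracted. *)
Lemma mx_bidiag_step l p j (A : 'M[C]_(l, p)) (P : 'M[C]_(p, j))
    (Q : 'M[C]_(l, j)) (B : 'M[C]_j) (w v : 'cV[C]_p) (e : 'cV[C]_j) :
    Q ^t* *m Q = 1%:M -> A ^t* *m Q = P *m B ^t* + w *m e ^t* ->
    P ^t* *m v = 0 ->
  Q ^t* *m (A *m v - Q *m (e *m (w ^t* *m v))) = 0.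
Proof.
move=> QQ AQ Pv.
have AQ' : Q ^t* *m A = B *m P ^t* + e *m w ^t*.
  have := congr1 (fun M : 'M[C]_(p, j) => M ^t*) AQ.
  by rewrite adjmxM trmxCK adjmxD !adjmxM !trmxCK.
rewrite mulmxBr !mulmxA QQ mul1mx AQ' mulmxDl -[B *m _ *m v]mulmxA Pv.
by rewrite mulmx0 add0r subrr.
Qed.

(* [w] is the residual of the first [j] columns, [v] and [q] the new right and
   left directions. *)
Lemma mx_bidiag_extend l p j (A : 'M[C]_(l, p)) (P : 'M[C]_(p, j))
    (Q : 'M[C]_(l, j)) (B : 'M[C]_j) (w v : 'cV[C]_p) (q : 'cV[C]_l)
    (e b : 'cV[C]_j) (c : 'M[C]_1) :
    Q ^t* *m Q = 1%:M -> P ^t* *m P = 1%:M ->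
    A *m P = Q *m B -> A ^t* *m Q = P *m B ^t* + w *m e ^t* ->
    v ^t* *m v = 1%:M -> P ^t* *m v = 0 -> w = v *m (v ^t* *m w) ->
    q ^t* *m q = 1%:M -> Q ^t* *m q = 0 ->
    b = e *m (w ^t* *m v) -> A *m v = Q *m b + q *m c ->
  let P' := row_mx P v in let Q' := row_mx Q q in
  let B' := block_mx B b 0 c in
  let w' := A ^t* *m q - v *m c ^t* in
  [/\ P' ^t* *m P' = 1%:M, Q' ^t* *m Q' = 1%:M, P' ^t* *m w' = 0,
      A *m P' = Q' *m B' &
      A ^t* *m Q' = P' *m B' ^t* + w' *m (col_mx 0 1%:M : 'cV[C]_(j + 1)) ^t*].
Proof.
move=> QQ PP AP AQ vv Pv wE qq Qq bE AvE P' Q' B' w'.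
have swap l' j' i' (X : 'M[C]_(l', j')) (Y : 'M[C]_(l', i')) :
    X ^t* *m Y = 0 -> Y ^t* *m X = 0.
  by move=> XY; rewrite -[Y ^t* *m X]trmxCK adjmxM trmxCK XY adjmx0.
split.
- rewrite adjmx_row mul_col_row PP vv Pv (swap _ _ _ _ _ Pv).
  by rewrite -scalar_mx_block.
- rewrite adjmx_row mul_col_row QQ qq Qq (swap _ _ _ _ _ Qq).
  by rewrite -scalar_mx_block.
- rewrite adjmx_row mul_col_mx !mulmxBr !mulmxA Pv vv mul0mx mul1mx subr0.
  (* The [P] block vanishes because [A *m P] lies in the range of [Q], orthogonal to [q]; in the [v]
     block the component of [A *m v] along [q] gives [c ^t*], which cancels. *)
  rewrite -!adjmxM AP AvE !adjmxM adjmxD !adjmxM mulmxDl -!mulmxA Qq qq.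
  by rewrite !mulmx0 mulmx1 add0r subrr col_mx0.
- by rewrite mul_mx_row mul_row_block AP AvE mulmx0 addr0.
rewrite mul_mx_row adjmx_block adjmx0 mul_row_block mulmx0 add0r.
rewrite (_ : (col_mx 0 1%:M) ^t* = row_mx 0 1%:M); last first.
  by rewrite tr_col_mx map_row_mx trmx0 map_mx0 trmx1 map_mx1.
rewrite mul_mx_row add_row_mx mulmx0 addr0 mulmx1 [v *m _ + w']addrC subrK.
(* Since [w = v *m (v ^t* *m w)], the old residual term [w *m e ^t*] equals [v *m b ^t*] and is
   absorbed by the new column of the triangular factor. *)
by rewrite AQ {1}wE bE !adjmxM trmxCK !mulmxA.
Qed.

End Extension.

(** * Iteration of the step on real tensors *)

Section Bidiagonalization.
Variable R : realType.

(** The residual [w] is kept unnormalized: it stands for the product of the last tube with the next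
    right slice. [B] is only upper triangular, since the arrow-shaped start is not bidiagonal in
    general. *)
Record bidiag l p j n (A : tensor R l p n) (P : tensor R p j n)
    (Q : tensor R l j n) (B : tensor R j j n) (w : tensor R p 1 n) : Prop := {
  bidiag_P : orthonormal_slices P;
  bidiag_Q : orthonormal_slices Q;
  bidiag_B : upper_triangular B;
  bidiag_w : orthogonal_to P w;
  bidiag_AP : A *t P = Q *t B;
  bidiag_AHQ : A^H *t Q = P *t B^H + w *t (tcan R j n)^H }.

(** The strict bounds on [j] leave room for a new direction on both sides. The tensors are built
    globally from real completions, and each conclusion is then checked at every frequency by
    [mx_bidiag_extend]. *)
Lemma bidiag_extend l p j n (A : tensor R l p n) (P : tensor R p j n)
    (Q : tensor R l j n) (B : tensor R j j n) (w : tensor R p 1 n) :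
    (j < l)%N -> (j < p)%N -> bidiag A P Q B w ->
  exists (v : tensor R p 1 n) (q : tensor R l 1 n) B' w',
    bidiag A (tcat P v) (tcat Q q) B' w'.
Proof.
move=> jl jp [P1 Q1 /upper_triangularP Bup Pw /tprod_eqP AP
  /tprod_therm_eqP AHQ].
have [v [v1 Pv wE]] := orthonormal_completion jp P1 Pw.
have {}wE k : hat w k = hat v k *m ((hat v k) ^t* *m hat w k).
  by rewrite -hat_therm -!hat_tprod -wE.
move: v1 Pv => /orthonormal_slicesP v1 /orthogonal_toP Pv.
move: P1 (Q1) => /orthonormal_slicesP P1 /orthonormal_slicesP Q1'.
pose b := tcan R j n *t (w^H *t v).
have bE k : hat b k = hat (tcan R j n) k *m ((hat w k) ^t* *m hat v k).
  by rewrite !hat_tprod hat_therm.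
pose y := A *t v - Q *t b.
have yE k : hat y k = hat A k *m hat v k - hat Q k *m hat b k.
  exact: hat_tprodB.
have Qy : orthogonal_to Q y.
  apply/orthogonal_toP => k; rewrite yE bE.
  exact: mx_bidiag_step (Q1' k) (AHQ k) (Pv k).
have [q [/orthonormal_slicesP q1 /orthogonal_toP Qq y_q]] :=
  orthonormal_completion jl Q1 Qy.
(* The new diagonal tube is the coefficient in [y = q *t c]. *)
pose c := q^H *t y.
pose B' : tensor R (j + 1) (j + 1) n :=
  [ffun f => block_mx (B f) (b f) 0 (c f)].
pose w' := A^H *t q - v *t c^H.
have AvE k : hat A k *m hat v k = hat Q k *m hat b k + hat q k *m hat c k.
  apply/eqP; rewrite addrC -subr_eq -yE; apply/eqP.
  exact: (etrans (congr1 (fun X => hat X k) y_q) (hat_tprod q c k)).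
have B'E k : hat B' k = block_mx (hat B k) (hat b k) 0 (hat c k).
  exact: (hat_block B b c k).
have w'E k : hat w' k = (hat A k) ^t* *m hat q k - hat v k *m (hat c k) ^t*.
  by rewrite hat_tprodB !hat_therm.
have canE k : hat (tcan R (j + 1) n) k = col_mx 0 1%:M.
  rewrite hat_tcan; apply/colP => i; rewrite !mxE.
  case: splitP => i' ->; rewrite !mxE addn1 eqSS.
    by rewrite ltn_eqF ?ltn_ord.
  by rewrite !ord1 addn0 eqxx.
have PvE k := hat_tcat P v k.
have QqE k := hat_tcat Q q k.
have step k := mx_bidiag_extend (Q1' k) (P1 k) (AP k) (AHQ k) (v1 k)
  (Pv k) (wE k) (q1 k) (Qq k) (bE k) (AvE k).
exists v, q, B', w'; split.
- by apply/orthonormal_slicesP => k; rewrite PvE; case: (step k).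
- by apply/orthonormal_slicesP => k; rewrite QqE; case: (step k).
- apply/upper_triangularP => k i i'; rewrite B'E !mxE.
  case: splitP => x ->; rewrite !mxE; case: splitP => x' -> ltx;
    rewrite ?mxE //.
  + exact: Bup.
  + by move: ltx; rewrite ltnNge ltnW // ltn_addr.
  + by move: ltx; rewrite !ord1 ltnn.
- by apply/orthogonal_toP => k; rewrite PvE w'E; case: (step k).
- by apply/tprod_eqP => k; rewrite PvE QqE B'E; case: (step k).
- apply/tprod_therm_eqP => k; rewrite PvE QqE B'E w'E canE.
  by case: (step k).
Qed.

(** Induction on [m]: new slices are appended on the right, so the initial ones persist. The theorem
    applies this with [k + 1] in place of [k]. *)
Lemma bidiag_complete l p m k n (A : tensor R l p n) (P : tensor R p k n)
    (Q : tensor R l k n) (B : tensor R k k n) (w : tensor R p 1 n) :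
    (k <= m)%N -> (m <= minn l p)%N -> bidiag A P Q B w ->
  exists (Pm : tensor R p m n) (Qm : tensor R l m n) Bm wm,
    bidiag A Pm Qm Bm wm /\
    forall (i : 'I_k) (i' : 'I_m), i' = i :> nat ->
      lateral Pm i' = lateral P i /\ lateral Qm i' = lateral Q i.
Proof.
move=> + + AP; elim: m => [|m IH].
  rewrite leqn0 => /eqP k0 _; subst k.
  by exists P, Q, B, w; split=> // -[].
rewrite leq_eqVlt => /predU1P[kE _|km mlp].
  subst k; exists P, Q, B, w; split=> // i i' /val_inj ->.
  by [].
have [Pm [Qm [Bm [wm [APm sub]]]]] := IH km (ltnW mlp).
(* The target size is now [m.+1], so its bound gives the strict inequalities [m < l] and [m < p]
   required by the step. *)
move: mlp; rewrite leq_min => /andP[ml mp].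
have [v [q [B' [w' AP']]]] := bidiag_extend ml mp APm.
rewrite -addn1; exists (tcat Pm v), (tcat Qm q), B', w'; split=> // i i' i'E.
have im : (i < m)%N := leq_trans (ltn_ord i) km.
have -> : i' = lshift 1 (Ordinal im) by apply: val_inj.
by rewrite !lateral_tcatl; apply: sub.
Qed.

Lemma arrow_upper_triangular k n (s rho : 'I_k -> tensor R 1 1 n)
    (alpha : tensor R 1 1 n) :
  upper_triangular (arrow s rho alpha).
Proof.
move=> i j ji; apply/ffunP => f; rewrite !ffunE.
set M := block_mx _ _ _ _; suff -> : M i j = 0 by rewrite raddf0.
rewrite /M !mxE; case: splitP => x xE; rewrite !mxE; case: splitP => y yE;
  rewrite ?mxE //; move: ji; rewrite xE yE.
- by move=> yx; rewrite -val_eqE gtn_eqF.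
- by rewrite ltnNge ltnW // ltn_addr.
- by rewrite !ord1 ltnn.
Qed.

Lemma tscale1 l p n (A : tensor R l p n) : tid R 1 n *:t A = A.
Proof. by apply/hat_eqP => f; rewrite hat_tscale hat_tid mxE scale1r. Qed.

Lemma orthogonal_to_tscale l p n (X : tensor R l p n) a (Y : tensor R l 1 n) :
  orthogonal_to X Y -> orthogonal_to X (a *:t Y).
Proof.
move=> /orthogonal_toP XY; apply/orthogonal_toP => f.
by rewrite hat_tscale -scalemxAr XY scaler0.
Qed.

End Bidiagonalization.

Theorem theorem10 (R : realType) (l p n m k : nat)
    (n_gt0 : (0 < n)%N) (m_le : (m <= minn l p)%N)
    (k_ge1 : (1 <= k)%N) (km : (k < m)%N)
    (A : tensor R l p n)
    (P : tensor R p m n) (Q : tensor R l m n) (B : tensor R m m n)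
    (r : tensor R p 1 n)
    (U S V : tensor R m m n)
    (pm1 : tensor R p 1 n) (betam : tensor R 1 1 n)
    (rho : 'I_k -> tensor R 1 1 n)
    (rk : tensor R l 1 n) (alpha : tensor R 1 1 n)
    (Pt : tensor R p (k + 1) n) (Qt : tensor R l (k + 1) n)
    (Bt : tensor R (k + 1) (k + 1) n)
    (Pnext : tensor R p 1 n) (betat : tensor R 1 1 n)
    (lanczos : lanczos_bidiag A P Q B r)
    (svdB : tsvd B U S V)
    (augm : ritz_augmented km A P Q r U S V pm1 betam rho rk alpha
              Pt Qt Bt Pnext betat)
    (APt : A *t Pt = Qt *t Bt)
    (AHQt : A^H *t Qt = Pt *t Bt^H + betat *:t Pnext *t (tcan R (k + 1) n)^H)
    (betat_neq0 : betat != 0) :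
  exists (Pm : tensor R p m n) (Qm : tensor R l m n) (Bm : tensor R m m n)
         (betatm : tensor R 1 1 n) (Plast : tensor R p 1 n),
    [/\ orthonormal_slices Pm, orthonormal_slices Qm, upper_triangular Bm &
        orthogonal_to Pm Plast] /\
    A *t Pm = Qm *t Bm /\
    A^H *t Qm = Pm *t Bm^H + betatm *:t Plast *t (tcan R m n)^H /\
    (forall i : 'I_k,
        lateral Pm (widen_ord (ltnW km) i) = lateral Pt (lshift 1 i)) /\
    (forall i : 'I_k,
        lateral Qm (widen_ord (ltnW km) i) = lateral Qt (lshift 1 i)).

Proof.
case: augm => _ _ Pt1 _ _ _ Qt1 BtE _ Pt_next.
(* The starting point has [k + 1] slices and the product [betat *:t Pnext] as its residual. *)
have APt' : bidiag A Pt Qt Bt (betat *:t Pnext).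
  constructor; [exact: Pt1|exact: Qt1| | |exact: APt|exact: AHQt].
    by rewrite BtE; exact: arrow_upper_triangular.
  exact: orthogonal_to_tscale Pt_next.
have k1m : (k + 1 <= m)%N by rewrite addn1.
have [Pm [Qm [Bm [w [[P1 Q1 Bm_up Pw AP AHQ] sub]]]]] :=
  bidiag_complete k1m m_le APt'.
(* The final residual serves as the last slice, with the identity tube as its coefficient; the
   conclusion asks this slice to be orthogonal to [Pm]. *)
exists Pm, Qm, Bm, (tid R 1 n), w; rewrite tscale1.
split; [split; [exact: P1|exact: Q1|exact: Bm_up|exact: Pw]|].
split; [exact: AP|split; [exact: AHQ|]].
by split=> i; have [] := sub (lshift 1 i) (widen_ord (ltnW km) i) erefl.
Qed.
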